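(* For every integer $n\ge 1$, the lattice graph $L_n$ satisfies $$s(L_n)=\frac{2n}{2n+1},$$ and consequently $s(L_n)\to 1$ as $n\to\infty$.
   Context: A quadruple $\square=\{a,b,c,d\}$ in a metric space $(X,d)$ is a choice of four (not necessarily distinct) points of $X$. Its three pairwise distance sums are $d(a,b)+d(c,d)$, $d(a,c)+d(b,d)$, $d(a,d)+d(b,c)$; label them so that $S\le M\le L$, and set $\delta(\square)=\frac{L-M}{2}$. The diameter $D(\square)$ is the largest distance between two points of $\square$. Let $\mathrm{Dist}_X=\{d(a,b):a,b\in X\}$, and define $\Gamma_X:\mathrm{Dist}_X\to\mathbb{R}$ by $\Gamma_X(x)=\sup_{\square\subset X:\,D(\square)=x}\delta(\square)$. For a finite connected weighted graph $G$ with the path metric (the distance between two vertices is the minimal total edge weight of a path joining them; unweighted graphs have all edge weights equal to one), with diameter $D(G)$, set $$s(G)=\frac{4\sum_{i\in\mathrm{Dist}_G}\Gamma_G(i)}{D(G)(D(G)+1)}.$$ The lattice graph $L_n$ is the set $\{0,\dots,n\}\times\{0,\dots,n\}$ with the metric $d((x_1,y_1),(x_2,y_2))=|x_1-x_2|+|y_1-y_2|$ (the path metric of the unweighted square grid); its diameter is $2n$ and $\mathrm{Dist}_{L_n}=\{0,\dots,2n\}$. *)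

(* Defs.v *)
From HB Require Import structures.
From mathcomp Require Import all_boot all_order all_algebra.
From mathcomp Require Import all_classical all_reals all_analysis.
From mathcomp Require Import zify ring lra.

Set Implicit Arguments.
Unset Strict Implicit.
Unset Printing Implicit Defensive.

Import Order.TTheory GRing.Theory Num.Theory.
Import numFieldNormedType.Exports.

Local Open Scope classical_set_scope.
Local Open Scope ring_scope.

(* Only the distance function matters here; it is applied below to the path
   metric of a graph. *)
Section FourPoints.
Variables (R : realType) (X : Type) (d : X -> X -> R).

Definition diam (s : seq X) : R :=
  \big[Num.max/0]_(x <- s) \big[Num.max/0]_(y <- s) d x y.

Definition quadruple : Type := (X * X * X * X)%type.

Definition quad_diam (q : quadruple) : R :=
  let: (a, b, c, e) := q in diam [:: a; b; c; e].

(* The sorted sequence is [:: S; M; L]. *)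
Definition quad_delta (q : quadruple) : R :=
  let: (a, b, c, e) := q in
  let sums := sort <=%R
    [:: d a b + d c e; d a c + d b e; d a e + d b c] in
  (sums`_2 - sums`_1) / 2.

Definition Dist : set R := [set r | exists a b : X, d a b = r].

(* A total function; only its values on [Dist] are meaningful. *)
Definition Gamma (x : R) : R :=
  sup [set quad_delta q | q in [set q | quad_diam q = x]].

End FourPoints.

Record wgraph (R : realType) := WGraph {
  vertex :> finType;
  adj : rel vertex;
  weight : vertex -> vertex -> R;  (* relevant on adjacent pairs only *)
  adj_sym : symmetric adj;
  adj_irr : irreflexive adj;
  weight_sym : forall x y, adj x y -> weight x y = weight y x;
  weight_gt0 : forall x y, adj x y -> 0 < weight x y;
  adj_connected : forall x y, connect adj x y
}.

Arguments adj {R} G : rename.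
Arguments weight {R} G : rename.

Section Graphs.
Variables (R : realType) (G : wgraph R).

(* The path visits x and then, in order, the vertices of p. *)
Definition path_weight (x : G) (p : seq G) : R :=
  \sum_(w <- pairmap (weight G) x p) w.

Definition path_dist (x y : G) : R :=
  inf [set path_weight x p | p in [set p | path (adj G) x p /\ last x p = y]].

Definition graph_diam : R := diam path_dist (enum G).

Definition s_graph : R :=
  4 * (\sum_(i \in Dist path_dist) Gamma path_dist i)
    / (graph_diam * (graph_diam + 1)).

End Graphs.

Section Lattice.
Variables (R : realType) (n : nat).

Local Notation V := ('I_n.+1 * 'I_n.+1)%type.

Definition consecutive (i j : 'I_n.+1) : bool :=
  (i.+1 == j :> nat) || (j.+1 == i :> nat).

Definition lattice_adj : rel V := fun u v =>
  (u.1 == v.1) && consecutive u.2 v.2 || consecutive u.1 v.1 && (u.2 == v.2).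

Local Definition ndist (i j : nat) : nat := (i - j) + (j - i).
Local Definition l1 (u v : V) : nat := ndist u.1 v.1 + ndist u.2 v.2.

Lemma lattice_adj_l1 u v : lattice_adj u v = (l1 u v == 1%N).
Proof.
rewrite /lattice_adj /consecutive /l1 /ndist -!val_eqE /=.
by case: u v => [i j] [k l] /=; lia.
Qed.

Lemma lattice_adj_sym : symmetric lattice_adj.
Proof. by move=> u v; rewrite !lattice_adj_l1 /l1 /ndist; lia. Qed.

Lemma lattice_adj_irr : irreflexive lattice_adj.
Proof. by move=> u; rewrite lattice_adj_l1 /l1 /ndist; lia. Qed.

Lemma lattice_step u v (k : nat) : l1 u v = k.+1 ->
  exists2 w, lattice_adj u w & l1 w v = k.
Proof.
case: u v => [i j] [i' j']; rewrite /l1 /ndist /= => h.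
have [hi|hi|hi] := ltngtP i i'.
- have b : (i.+1 < n.+1)%N by have := ltn_ord i'; lia.
  exists (Ordinal b, j); first by rewrite lattice_adj_l1 /l1 /ndist /=; lia.
  by rewrite /l1 /ndist /=; lia.
- have b : (i.-1 < n.+1)%N by have := ltn_ord i; lia.
  exists (Ordinal b, j); first by rewrite lattice_adj_l1 /l1 /ndist /=; lia.
  by rewrite /l1 /ndist /=; lia.
have [hj|hj|hj] := ltngtP j j'.
- have b : (j.+1 < n.+1)%N by have := ltn_ord j'; lia.
  exists (i, Ordinal b); first by rewrite lattice_adj_l1 /l1 /ndist /=; lia.
  by rewrite /l1 /ndist /=; lia.
- have b : (j.-1 < n.+1)%N by have := ltn_ord j; lia.
  exists (i, Ordinal b); first by rewrite lattice_adj_l1 /l1 /ndist /=; lia.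
  by rewrite /l1 /ndist /=; lia.
by lia.
Qed.

Lemma lattice_geodesic u v :
  exists p, [/\ path lattice_adj u p, last u p = v & size p = l1 u v].
Proof.
move: {2}(l1 u v) (erefl (l1 u v)) => k; elim: k u => [|k IH] u h.
  exists [::]; split=> //=; case: u v h => [i j] [i' j'].
  rewrite /l1 /ndist /= => h.
  by congr pair; apply: val_inj => /=; move: h => /=; lia.
have [w uw wv] := lattice_step h.
have [p [hp hl hs]] := IH _ wv.
by exists (w :: p); split=> //=; rewrite ?uw // hs wv h.
Qed.

Lemma lattice_path_size u p :
  path lattice_adj u p -> (l1 u (last u p) <= size p)%N.
Proof.
elim: p u => [|w p IH] u /=; first by rewrite /l1 /ndist; lia.
case/andP; rewrite lattice_adj_l1 => /eqP uw /IH.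
move: uw; move: (last w p) => v; rewrite /l1 /ndist.
by case: u w v => [a b] [c e] [f g] /=; lia.
Qed.

Lemma lattice_connected u v : connect lattice_adj u v.
Proof.
by have [p [hp <- _]] := lattice_geodesic u v; apply/connectP; exists p.
Qed.

Definition lattice_graph : wgraph R :=
  @WGraph R V lattice_adj (fun _ _ => 1)
    lattice_adj_sym lattice_adj_irr (fun _ _ _ => erefl) (fun _ _ _ => ltr01)
    lattice_connected.

Lemma lattice_path_weight (u : lattice_graph) p :
  path_weight u p = (size p)%:R.
Proof.
rewrite /path_weight; elim: p u => [|w p IH] u /=; first by rewrite big_nil.
by rewrite big_cons IH -natr1 addrC.
Qed.

Lemma lattice_distE (u v : lattice_graph) :
  path_dist u v = `|(u.1 : nat)%:R - (v.1 : nat)%:R|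
                + `|(u.2 : nat)%:R - (v.2 : nat)%:R|.
Proof.
have ndistE (i j : nat) : `|i%:R - j%:R| = (ndist i j)%:R :> R.
  rewrite /ndist; have [h|h] := leqP i j.
    rewrite distrC -natrB // normr_nat; congr (_%:R); lia.
  rewrite -natrB 1?ltnW // normr_nat; congr (_%:R); lia.
rewrite !ndistE -natrD -/(l1 u v).
have [p [hp hl hs]] := lattice_geodesic u v.
apply/eqP; rewrite eq_le; apply/andP; split.
  apply: ge_inf.
    exists 0 => _ [q _ <-]; rewrite lattice_path_weight; exact: ler0n.
  by exists p => //; rewrite lattice_path_weight hs.
apply: lb_le_inf.
  by exists (path_weight (u : lattice_graph) p), p.
move=> _ [q [hq <-] <-]; rewrite lattice_path_weight ler_nat.
exact: lattice_path_size.
Qed.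

End Lattice.

(* Main.v *)
Require Import Defs.
From mathcomp Require Import all_boot all_order all_algebra.
From mathcomp Require Import all_classical all_reals all_analysis.
From mathcomp Require Import zify ring lra.

Import Order.TTheory GRing.Theory Num.Theory.
Import numFieldNormedType.Exports.

Local Open Scope classical_set_scope.
Local Open Scope ring_scope.

(** The point is that Gamma takes the value floor(k/2) at every distance k of
    the grid, that is for k = 0, ..., 2n.

    Upper bound ([lattice_delta_le]): if ab + ce is the largest of the three
    sums, the triangle inequality through c and through e gives
    2 ab <= (ac + bc) + (ae + be), so the middle sum M is at least ab; hence
    L - M <= ce <= k and delta <= k/2. The grid is bipartite, so the three sums
    all have the parity of the sum of the eight coordinates; L - M is therefore
    even, delta is an integer, and delta <= floor(k/2).

    Lower bound ([lattice_rectangle]): the corners of a floor(k/2) x ceil(k/2)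
    rectangle, which fits in the grid because k <= 2n, have diameter k, and
    their sums are 2 floor(k/2), 2 ceil(k/2) and 2k.

    Summing, floor(0/2) + ... + floor(2n/2) = n^2, whence
    s = 4 n^2 / (2n (2n + 1)) = 2n / (2n + 1), which lies between
    1 - 1/(n + 1) and 1. *)

Lemma le_diam (R : realType) (X : eqType) (d : X -> X -> R) (s : seq X)
    (x y : X) : x \in s -> y \in s -> d x y <= diam d s.
Proof.
move=> xs ys; rewrite /diam; apply: (bigmax_sup_seq _ x) => //.
exact: (bigmax_sup_seq _ y).
Qed.

Lemma diam_eq (R : realType) (X : eqType) (d : X -> X -> R) (s : seq X)
    (r : R) (x y : X) :
  x \in s -> y \in s -> d x y = r -> 0 <= r ->
  (forall u v, u \in s -> v \in s -> d u v <= r) -> diam d s = r.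
Proof.
move=> xs ys dxy r0 h; apply/eqP; rewrite eq_le; apply/andP; split.
  rewrite /diam big_seq; apply: bigmax_le => // u us.
  by rewrite big_seq; apply: bigmax_le => // v vs; exact: h.
by rewrite -dxy; exact: le_diam.
Qed.

(** Whichever of the three numbers is the largest, the larger of the other two
    is the middle one; symmetric hypotheses let this be applied to four points
    without knowing which pairing gives L. *)
Lemma sort3_gap_le (R : realType) (x y z t : R) :
  x <= Num.max y z + t -> y <= Num.max x z + t -> z <= Num.max x y + t ->
  (sort <=%R [:: x; y; z])`_2 - (sort <=%R [:: x; y; z])`_1 <= t.
Proof.
rewrite /sort /= !maxEle.
by case: (leP x y) => ? /=; case: (leP x z) => ? /=; case: (leP y z) => ? /=;
  lra.
Qed.

Section Grid.
Variables (R : realType) (n : nat).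
Local Notation V := ('I_n.+1 * 'I_n.+1)%type.
Local Notation dist := (@path_dist R (lattice_graph R n)).

(** Natural-number distances make the parity argument possible. *)
Lemma lattice_dist_nat (u v : lattice_graph R n) :
  dist u v = (Defs.l1 u v)%:R.
Proof.
have ndistE (i j : nat) : `|i%:R - j%:R| = (Defs.ndist i j)%:R :> R.
  rewrite /Defs.ndist; have [h|h] := leqP i j.
    by rewrite distrC -natrB // normr_nat; congr (_%:R); lia.
  by rewrite -natrB 1?ltnW // normr_nat; congr (_%:R); lia.
by rewrite lattice_distE !ndistE -natrD.
Qed.

Lemma l1C (u v : V) : Defs.l1 u v = Defs.l1 v u.
Proof. by rewrite /Defs.l1 /Defs.ndist; lia. Qed.

Lemma l1_triangle (u v w : V) : (Defs.l1 u w <= Defs.l1 u v + Defs.l1 v w)%N.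
Proof. by rewrite /Defs.l1 /Defs.ndist; lia. Qed.

(** The grid is bipartite: colour a vertex by the parity of x + y. *)
Lemma odd_l1 (u v : V) :
  odd (Defs.l1 u v) = odd (u.1 + u.2) (+) odd (v.1 + v.2).
Proof.
have odd_ndist i j : odd (Defs.ndist i j) = odd i (+) odd j.
  by rewrite /Defs.ndist; lia.
rewrite /Defs.l1 oddD !odd_ndist !oddD.
by do 4 case: (odd _).
Qed.

Lemma l1_le (u v : V) : (Defs.l1 u v <= n.*2)%N.
Proof.
have := (ltn_ord u.1, ltn_ord u.2, ltn_ord v.1, ltn_ord v.2).
by rewrite /Defs.l1 /Defs.ndist => -[[[? ?] ?] ?]; lia.
Qed.

Lemma odd_l1D (a b c e : V) :
  odd (Defs.l1 a b + Defs.l1 c e) =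
  odd (a.1 + a.2) (+) odd (b.1 + b.2) (+) (odd (c.1 + c.2) (+) odd (e.1 + e.2)).
Proof. by rewrite oddD !odd_l1. Qed.

(** The triangle inequality through c and through e puts the average of the two
    sums on the right, hence their maximum, above ab, so the excess of the left
    side is at most ce <= k. All three sums have the same parity, which rounds
    an odd k down to 2 floor(k/2). *)
Lemma l1_four_points (a b c e : V) (k : nat) : (Defs.l1 c e <= k)%N ->
  (Defs.l1 a b + Defs.l1 c e <=
   maxn (Defs.l1 a c + Defs.l1 b e) (Defs.l1 a e + Defs.l1 b c) +
   (k./2).*2)%N.
Proof.
move=> cek.
have := l1_triangle a c b; rewrite (l1C c b) => t1.
have := l1_triangle a e b; rewrite (l1C e b) => t2.
have p1 : odd (Defs.l1 a b + Defs.l1 c e) = odd (Defs.l1 a c + Defs.l1 b e).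
  by rewrite !odd_l1D; do 4 case: (odd (_ + _)).
have p2 : odd (Defs.l1 a b + Defs.l1 c e) = odd (Defs.l1 a e + Defs.l1 b c).
  by rewrite !odd_l1D; do 4 case: (odd (_ + _)).
by lia.
Qed.

Lemma lattice_delta_le (k : nat) (q : quadruple (lattice_graph R n)) :
  quad_diam dist q = k%:R -> quad_delta dist q <= (k./2)%:R.
Proof.
move: q => [[[a b] c] e] /= Dk.
have le_k u v : u \in [:: a; b; c; e] -> v \in [:: a; b; c; e] ->
    (Defs.l1 u v <= k)%N.
  by move=> us vs; rewrite -(ler_nat R) -lattice_dist_nat -Dk; exact: le_diam.
have cek : (Defs.l1 c e <= k)%N by apply: le_k; rewrite !inE eqxx ?orbT.
have bek : (Defs.l1 b e <= k)%N by apply: le_k; rewrite !inE eqxx ?orbT.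
have bck : (Defs.l1 b c <= k)%N by apply: le_k; rewrite !inE eqxx ?orbT.
have h1 := l1_four_points a b c e k cek.
have h2 := l1_four_points a c b e k bek.
have h3 := l1_four_points a e b c k bck.
rewrite (l1C c b) in h2; rewrite (l1C e c) (l1C e b) in h3.
rewrite ler_pdivrMr // -natrM muln2 !lattice_dist_nat -!natrD.
by apply: sort3_gap_le; rewrite -natr_max -natrD ler_nat.
Qed.

(** The corners of a floor(k/2) x ceil(k/2) rectangle, ordered so that the three
    sums come out as S, M, L: twice the short side, twice the long side, twice
    the diagonal distance. *)
Lemma lattice_rectangle (k : nat) : (k <= n.*2)%N ->
  exists q : quadruple (lattice_graph R n),
    quad_diam dist q = k%:R /\ quad_delta dist q = (k./2)%:R.
Proof.
move=> kn; pose i := k./2; pose j := uphalf k.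
have ij : (i <= j)%N by rewrite /i /j; lia.
have ijk : (i + j = k)%N by rewrite /i /j; lia.
have lti : (i < n.+1)%N by rewrite /i; lia.
have ltj : (j < n.+1)%N by rewrite /j; lia.
pose a : V := (ord0, ord0); pose b : V := (Ordinal lti, ord0).
pose c : V := (ord0, Ordinal ltj); pose e : V := (Ordinal lti, Ordinal ltj).
exists (a, b, c, e); split.
  apply: (@diam_eq R (lattice_graph R n) _ _ _ a e); rewrite ?inE ?eqxx ?orbT //.
    by rewrite lattice_dist_nat -ijk; congr (_%:R);
      rewrite /Defs.l1 /Defs.ndist /=; lia.
  move=> u v; rewrite !inE => /or4P[] /eqP -> /or4P[] /eqP ->;
    by rewrite lattice_dist_nat ler_nat /Defs.l1 /Defs.ndist /=; lia.
rewrite /quad_delta !lattice_dist_nat -!natrD.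
have -> : (Defs.l1 a b + Defs.l1 c e = i.*2)%N.
  by rewrite /Defs.l1 /Defs.ndist /=; lia.
have -> : (Defs.l1 a c + Defs.l1 b e = j.*2)%N.
  by rewrite /Defs.l1 /Defs.ndist /=; lia.
have -> : (Defs.l1 a e + Defs.l1 b c = k.*2)%N.
  by rewrite /Defs.l1 /Defs.ndist /=; lia.
rewrite sorted_sort; [|exact: le_trans|].
  by rewrite /= -/i -!muln2 !natrM -ijk natrD; lra.
by rewrite /= !ler_nat; lia.
Qed.

Lemma lattice_Gamma (k : nat) : (k <= n.*2)%N ->
  Gamma dist k%:R = (k./2)%:R.
Proof.
move=> kn; have [q [Dq dq]] := lattice_rectangle k kn.
have ubd : ubound [set quad_delta dist p | p in [set p | quad_diam dist p = k%:R]]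
    (k./2)%:R.
  by move=> _ [p Dp <-]; exact: lattice_delta_le.
apply/eqP; rewrite eq_le; apply/andP; split.
  by apply: ge_sup => //; exists (quad_delta dist q), q.
by rewrite -dq; apply: ub_le_sup; [exists (k./2)%:R | exists q].
Qed.

Lemma lattice_Dist : Dist dist = [set k%:R | k in `I_(n.*2.+1)].
Proof.
apply/seteqP; split=> [_ [u [v <-]]|_ [k /= kn <-]].
  by exists (Defs.l1 u v); rewrite ?lattice_dist_nat //= ltnS l1_le.
have lti : (k./2 < n.+1)%N by lia.
have ltj : (uphalf k < n.+1)%N by lia.
exists (ord0, ord0), (Ordinal lti, Ordinal ltj).
by rewrite lattice_dist_nat; congr (_%:R); rewrite /Defs.l1 /Defs.ndist /=; lia.
Qed.

Lemma lattice_diam : graph_diam (lattice_graph R n) = 2 * n%:R.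
Proof.
rewrite /graph_diam.
apply: (@diam_eq R (lattice_graph R n) _ _ _ (ord0, ord0) (ord_max, ord_max)).
- by rewrite mem_enum.
- by rewrite mem_enum.
- rewrite lattice_dist_nat -natrM; congr (_%:R).
  by rewrite /Defs.l1 /Defs.ndist /=; lia.
- by rewrite mulr_ge0.
- by move=> u v _ _; rewrite lattice_dist_nat -natrM mul2n ler_nat l1_le.
Qed.

Lemma sum_half : (\sum_(k < n.*2.+1) k./2 = n ^ 2)%N.
Proof.
elim: n => [|m IH]; first by rewrite big_ord_recr big_ord0.
by rewrite doubleS !big_ord_recr /= in IH *; lia.
Qed.

Lemma lattice_sum_Gamma : \sum_(i \in Dist dist) Gamma dist i = n%:R ^+ 2.
Proof.
rewrite lattice_Dist fsbig_image; last first.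
  by move=> i j _ _ /eqP; rewrite eqr_nat => /eqP.
rewrite -fsbig_ord -natrX -sum_half natr_sum.
by apply: eq_bigr => k _; rewrite lattice_Gamma // -ltnS.
Qed.

End Grid.

Theorem mainTheorem5 (R : realType) :
  (forall n : nat, (1 <= n)%N ->
     s_graph (lattice_graph R n) = (2 * n%:R) / (2 * n%:R + 1)) /\
  ((fun n : nat => s_graph (lattice_graph R n)) @ \oo --> (1 : R)).
Proof.
have sE n : (1 <= n)%N ->
    s_graph (lattice_graph R n) = (2 * n%:R) / (2 * n%:R + 1).
  move=> n1; rewrite /s_graph lattice_sum_Gamma lattice_diam.
  have n0 : 0 < n%:R :> R by rewrite ltr0n.
  by field; apply/andP; split; apply: lt0r_neq0; lra.
split=> //.
have lo : (fun n => 1 - harmonic n : R) @ \oo --> (1 : R).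
  rewrite -[X in _ --> X]subr0.
  by apply: cvgB; [exact: cvg_cst | exact: cvg_harmonic].
apply: squeeze_cvgr lo (@cvg_cst _ (1 : R) _ _ _).
exists 1%N => // n /= n1; rewrite sE // /harmonic /= -natr1.
have n0 : 0 <= n%:R :> R by [].
have p1 : 0 < 2 * n%:R + 1 :> R by lra.
have p2 : 0 < n%:R + 1 :> R by lra.
have -> : 2 * n%:R / (2 * n%:R + 1) = 1 - (2 * n%:R + 1)^-1 :> R.
  by field; exact: lt0r_neq0.
rewrite gerBl invr_ge0 (ltW p1) andbT lerD2l lerN2 lef_pV2 ?posrE //; lra.
Qed.
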